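(* Let $m_1,m_2\in\mathbb{R}$ with $m_1\neq m_2$, and let $E=\{(x,y)\in\mathbb{R}^2: y=m_1x \text{ or } y=m_2x\}$ with the Euclidean distance $d$. Let $\Pi^1,\Pi^2$ be two independent homogeneous Poisson processes on $\mathbb{R}$ with rate $1$, and let $\Pi$ be the point process on $E$ obtained by placing $\Pi^i$ on the line $y=m_ix$ so that distances are preserved, i.e. for $i=1,2$ and all $a<b$, $\big|\Pi\cap\{(x,m_ix): x\sqrt{1+m_i^2}\in(a,b)\}\big|=|\Pi^i\cap(a,b)|$. Let $(S_n)_{n\ge 0}$ be the greedy walk on $\Pi$ starting from $S_0=(0,0)$. Then almost surely the greedy walk does not visit all points of $\Pi$. More precisely, almost surely the greedy walk visits only finitely many points on three of the four half-lines into which the point $(0,0)$ divides $E$.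
   Context: Greedy walk: given a simple point process $\Pi$ (viewed as a random set of points) in a metric space $(E,d)$ and a starting point $S_0\in E$, the greedy walk $(S_n)_{n\ge0}$ on $\Pi$ is defined recursively by $S_{n+1}=\arg\min\{d(X,S_n): X\in\Pi,\ X\notin\{S_0,S_1,\dots,S_n\}\}$, i.e. the walk always moves to the nearest not yet visited point. For the process considered here every step is almost surely uniquely defined. $|\Pi\cap B|$ denotes the number of points of $\Pi$ in $B$. *)

(* Defs.v *)
From HB Require Import structures.
From mathcomp Require Import all_boot all_order all_algebra.
From mathcomp Require Import all_classical all_reals all_analysis.
From mathcomp Require Import measurable_realfun.
From mathcomp Require Import ring lra.

Set Implicit Arguments.
Unset Strict Implicit.
Unset Printing Implicit Defensive.

Import Order.TTheory GRing.Theory Num.Theory.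
Import numFieldNormedType.Exports.

Local Open Scope classical_set_scope.
Local Open Scope ring_scope.

(* A simple point process on the real line is represented by its random set of
   points [Pi : T -> set R]. *)

Definition count {R : realType} {T : Type} (Pi : T -> set R) (B : set R)
    (w : T) : \bar R :=
  counting (Pi w `&` B).

Definition point_process {R : realType} {d : measure_display}
    {T : measurableType d} (Pi : T -> set R) : Prop :=
  (forall w (a b : R), finite_set (Pi w `&` `[a, b])) /\
  (forall B : set R, measurable B -> measurable_fun setT (count Pi B)).

(* The Poisson probabilities are written out because the library's
   [poisson_pmf] is identically 1 at parameter 0, whereas a Lebesgue-null [B]
   must have count 0.  Taking some [V i] to be [setT] gives the product rule
   for subfamilies. *)
Definition homogeneous_poisson {R : realType} {d : measure_display}
    {T : measurableType d} (P : probability T R) (rate : R)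
    (Pi : T -> set R) : Prop :=
  [/\ point_process Pi,
      forall (B : set R) (k : nat), measurable B ->
        (lebesgue_measure B < +oo)%E ->
        let r := rate * fine (lebesgue_measure B) in
        P [set w | count Pi B w = k%:R%:E] = (r ^+ k / k`!%:R * expR (- r))%:E &
      forall (n : nat) (B : 'I_n -> set R) (V : 'I_n -> set (\bar R)),
        (forall i, measurable (B i)) -> trivIset setT B ->
        (forall i, measurable (V i)) ->
        P (\bigcap_i (count Pi (B i) @^-1` V i)) =
        (\prod_(i < n) P (count Pi (B i) @^-1` V i))%E].

Definition sigma_process {R : realType} {T : Type} (Pi : T -> set R) :
    set_system T :=
  <<s \bigcup_(B in (measurable : set_system R))
        preimage_set_system setT (count Pi B) measurable >>.

Definition independent_processes {R : realType} {d : measure_display}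
    {T : measurableType d} (P : probability T R) (Pi1 Pi2 : T -> set R) : Prop :=
  forall A1 A2, sigma_process Pi1 A1 -> sigma_process Pi2 A2 ->
    P (A1 `&` A2) = (P A1 * P A2)%E.

(* A point of [A] nearest to [x]; if the minimum is attained several times one
   minimiser is chosen, and if it is not attained the value is [x]. *)
Definition nearest {R : realType} {M : metricType R} (A : set M) (x : M) : M :=
  xget x [set y | A y /\ forall z, A z -> mdist y x <= mdist z x].

(* [:: S_n; ...; S_0] *)
Fixpoint visited {R : realType} {M : metricType R} (Pi : set M) (s0 : M)
    (n : nat) : seq M :=
  if n is n'.+1 then
    let s := visited Pi s0 n' in nearest (Pi `\` [set` s]) (head s0 s) :: s
  else [:: s0].

Definition greedy_walk {R : realType} {M : metricType R} (Pi : set M) (s0 : M)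
    (n : nat) : M :=
  head s0 (visited Pi s0 n).

(* [R * R] canonically carries the sup distance in the library, hence an alias
   for the Euclidean plane. *)
Definition plane (R : realType) : Type := (R * R)%type.

Definition edist {R : realType} (p q : plane R) : R :=
  Num.sqrt ((p.1 - q.1) ^+ 2 + (p.2 - q.2) ^+ 2).

Lemma edistxx {R : realType} (p : plane R) : edist p p = 0.
Proof. by rewrite /edist !subrr expr0n addr0 sqrtr0. Qed.

Lemma edist_positivity {R : realType} (p q : plane R) :
  edist p q = 0 -> p = q.
Proof.
move=> /eqP; rewrite sqrtr_eq0 => h.
have := sqr_ge0 (p.1 - q.1); have := sqr_ge0 (p.2 - q.2) => h2 h1.
have /eqP : (p.1 - q.1) ^+ 2 = 0 by lra.
have /eqP : (p.2 - q.2) ^+ 2 = 0 by lra.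
rewrite !sqrf_eq0 !subr_eq0 => /eqP e2 /eqP e1.
by case: p q e1 e2 {h h1 h2} => [? ?] [? ?] /= -> ->.
Qed.

Lemma edist_sym {R : realType} (p q : plane R) : edist p q = edist q p.
Proof.
by rewrite /edist -(opprB q.1) sqrrN -(opprB q.2) sqrrN.
Qed.

Lemma edist_triangle {R : realType} (q p r : plane R) :
  edist p r <= edist p q + edist q r.
Proof.
rewrite /edist.
have -> : p.1 - r.1 = (p.1 - q.1) + (q.1 - r.1) by ring.
have -> : p.2 - r.2 = (p.2 - q.2) + (q.2 - r.2) by ring.
move: (p.1 - q.1) (q.1 - r.1) (p.2 - q.2) (q.2 - r.2) => a b c e.
set u := a ^+ 2 + c ^+ 2; set v := b ^+ 2 + e ^+ 2.
have u0 : 0 <= u by rewrite addr_ge0 ?sqr_ge0.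
have v0 : 0 <= v by rewrite addr_ge0 ?sqr_ge0.
have su := sqrtr_ge0 u; have sv := sqrtr_ge0 v.
rewrite -(@ler_pXn2r _ 2) ?nnegrE ?sqrtr_ge0 ?addr_ge0//.
rewrite [leRHS]sqrrD !sqr_sqrtr ?addr_ge0 ?sqr_ge0//.
have cs : a * b + c * e <= Num.sqrt u * Num.sqrt v.
  rewrite -sqrtrM//; apply: le_trans (ler_norm _) _.
  rewrite -sqrtr_sqr ler_wsqrtr//.
  have := sqr_ge0 (a * e - c * b); rewrite /u /v; nra.
have -> : (a + b) ^+ 2 + (c + e) ^+ 2 = u + v + 2 * (a * b + c * e).
  by rewrite /u /v; ring.
by lra.
Qed.

HB.instance Definition _ (R : realType) := Choice.on (plane R).
HB.instance Definition _ (R : realType) :=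
  isMetric.Build R (plane R) (@edistxx R) (@edist_positivity R)
    (@edist_sym R) (@edist_triangle R).

Definition origin (R : realType) : plane R := (0, 0).

(* The point of the line [y = m x] with [x * sqrt (1 + m ^ 2) = t]. *)
Definition line_point {R : realType} (m t : R) : plane R :=
  (t / Num.sqrt (1 + m ^+ 2), m * (t / Num.sqrt (1 + m ^+ 2))).

Lemma mdist_line_point {R : realType} (m s t : R) :
  mdist (line_point m s) (line_point m t) = `|s - t|.
Proof.
have m0 : 0 < 1 + m ^+ 2 by rewrite ltr_pwDl ?sqr_ge0.
have q0 : Num.sqrt (1 + m ^+ 2) != 0 by rewrite gt_eqF ?sqrtr_gt0.
rewrite -[LHS]/(edist _ _) -sqrtr_sqr /edist /=; congr Num.sqrt.
have e : (Num.sqrt (1 + m ^+ 2)) ^+ 2 = 1 + m ^+ 2 by rewrite sqr_sqrtr ?ltW.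
rewrite -mulrBr -mulrBl !exprMn exprVn e; field.
by rewrite gt_eqF.
Qed.

Definition two_line_process {R : realType} {T : Type} (m1 m2 : R)
    (Pi1 Pi2 : T -> set R) (w : T) : set (plane R) :=
  (line_point m1 @` Pi1 w) `|` (line_point m2 @` Pi2 w).

(* The four half-lines are indexed by the line [h.1] and the side [h.2]. *)
Definition half_line {R : realType} (m1 m2 : R) (h : bool * bool) :
    set (plane R) :=
  [set p | p.2 = (if h.1 then m1 else m2) * p.1 /\
           (if h.2 then 0 < p.1 else p.1 < 0)].

Lemma half_lineE {R : realType} (m1 m2 : R) :
  \bigcup_h half_line m1 m2 h =
  [set p | p.2 = m1 * p.1 \/ p.2 = m2 * p.1] `\ origin R.
Proof.
apply/seteqP; split=> [[x y] [[i s] _ [/= e xs]]|[x y] /= [e n0]].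
  split; first by case: i e; [left | right].
  by case=> x0 _; case: s xs; rewrite x0 ltxx.
have x0 : x != 0.
  by apply/eqP => x0; apply: n0; case: e => ->; rewrite x0 mulr0.
by case: e => e; [exists (true, 0 < x) | exists (false, 0 < x)] => //;
  split=> //=; case: ltrgt0P x0.
Qed.

(* Main.v *)
Require Import Defs.
From mathcomp Require Import all_boot all_order all_algebra.
From mathcomp Require Import all_classical all_reals all_analysis.
From mathcomp Require Import measurable_realfun.
From mathcomp Require Import finmap ring lra.

Import Order.TTheory GRing.Theory Num.Theory.
Import numFieldNormedType.Exports.

Local Open Scope classical_set_scope.
Local Open Scope ring_scope.

(** The randomness enters through one property: almost surely, on each half-line
    and for each e > 0, every interval (x, x + e x) with x large contains a
    point.  An interval of length proportional to k is empty with probability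
    exponentially small in k, so this is Borel--Cantelli
    ([poisson_eventually_hits], [poisson_dense]).  The rest is deterministic.

    Let N be the distance to the crossing point o and kappa < 1 the absolute
    value of the cosine of the angle between the lines.  By the law of cosines,
    a walker at y off a half-line h sees the points of h at increasing
    distances as soon as they lie beyond the foot of the perpendicular, hence
    beyond kappa N(y); and a walker at x on h is at distance at least
    (1 - kappa) N(x) from the other half-lines.

    Fix L beyond which every (x, x + (1 - kappa) x) is hit.  As long as the
    walk stays within distance L of o, the following is preserved at each step:
    if the walker is on h, the points q of h with kappa L < N(q) that are
    closer to o than the walker have all been visited ([sweptS]).  Indeed a
    walker that enters h at p passes over no unvisited point between kappa L
    and N(p), since such a point would be nearer, and a walker that moves
    along h jumps over visited points only.  So at the first time that the
    walker is at distance at least L, say on h, all points of h between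
    kappa N(S_n) and N(S_n) are visited, while nothing beyond is.  The next
    point outwards on h is at distance less than (1 - kappa) N(S_n), whereas
    the unvisited points inwards on h and all points of the other half-lines
    are at least that far.  Hence the walker moves outwards on h, the same
    situation recurs, and the walk never leaves h again
    ([greedy_walk_escapes]).  The other three half-lines are visited finitely
    often, and as they carry infinitely many points, some are missed. *)

(** * One step of the greedy walk *)

Lemma finite_set_argmin {R : realType} {T : choiceType} (f : T -> R)
    (F : set T) : F !=set0 -> finite_set F ->
  exists2 x, F x & forall y, F y -> f x <= f y.
Proof.
move=> [a Fa] /finite_seqP[s Fs]; have as_ : a \in s by move: Fa; rewrite Fs.
case: (arg_minP (P := xpredT) (fun x : seq_sub s => f (val x))
  (i0 := SeqSub as_)) => // x _ xm.
exists (val x); first by rewrite Fs /=; exact: valP.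
by move=> y; rewrite Fs /= => ys; exact: (xm (SeqSub ys)).
Qed.

Lemma nearestP {R : realType} {M : metricType R} (A : set M) (x : M) :
  A !=set0 -> (forall r, finite_set (A `&` [set y | mdist y x <= r])) ->
  A (nearest A x) /\ forall z, A z -> mdist (nearest A x) x <= mdist z x.
Proof.
move=> [a Aa] Afin.
have [|y [Ay yr] ymin] :=
  finite_set_argmin (fun y => mdist y x) _ _ (Afin (mdist a x)).
  by exists a; split => /=.
have : exists y, A y /\ forall z, A z -> mdist y x <= mdist z x.
  exists y; split => // z Az; have [za|/ltW az] := leP (mdist z x) (mdist a x).
    exact: ymin.
  exact: le_trans yr az.
by move=> /(xgetPex x).
Qed.

Definition locally_finite {R : realType} {M : metricType R} (A : set M) :
    Prop :=
  forall x r, finite_set (A `&` [set y | mdist y x <= r]).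

Lemma visitedS {R : realType} {M : metricType R} (A : set M) (o : M) n :
  visited A o n.+1 = greedy_walk A o n.+1 :: visited A o n.
Proof. by []. Qed.

Lemma greedy_walk_visited {R : realType} {M : metricType R} (A : set M)
    (o : M) n :
  greedy_walk A o n \in visited A o n.
Proof. by case: n => [|n] /=; rewrite inE eqxx. Qed.

Lemma visited_mono {R : realType} {M : metricType R} (A : set M) (o : M) m n q :
  (m <= n)%N -> q \in visited A o m -> q \in visited A o n.
Proof.
move=> /subnK <-; elim: (n - m)%N => // k IH /IH qk.
by rewrite addSn visitedS inE qk orbT.
Qed.

Lemma visitedP {R : realType} {M : metricType R} (A : set M) (o : M) n q :
  q \in visited A o n -> exists2 j, (j <= n)%N & q = greedy_walk A o j.
Proof.
elim: n => [|n IH]; first by rewrite inE => /eqP ->; exists 0%N.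
rewrite visitedS inE => /orP[/eqP ->|/IH[j jn ->]]; first by exists n.+1.
by exists j => //; exact: leqW.
Qed.

(** Minimality is recorded in contrapositive form, a closer point has been
    visited, because this is how the walk sweeps a half-line. *)
Lemma greedy_stepP {R : realType} {M : metricType R} (A : set M) (o : M) n :
  locally_finite A -> infinite_set A ->
  [/\ A (greedy_walk A o n.+1), greedy_walk A o n.+1 \notin visited A o n &
      forall z, A z ->
        mdist z (greedy_walk A o n) <
          mdist (greedy_walk A o n.+1) (greedy_walk A o n) ->
        z \in visited A o n].
Proof.
move=> Afin Ainf; set B := A `\` [set` visited A o n].
have Bn0 : B !=set0.
  apply: contrapT => /set0P/negP; rewrite negbK => /eqP B0; apply: Ainf.
  apply: (sub_finite_set _ (finite_seq (visited A o n))) => z Az.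
  by apply: contrapT => zv; have : B z by []; rewrite B0.
have [|[Aq qv] qmin] := nearestP _ (greedy_walk A o n) Bn0.
  move=> r.
  by apply: sub_finite_set (Afin (greedy_walk A o n) r) => z [[? _] ?].
split=> //; first exact/negP.
move=> z Az; rewrite ltNge => /negP zlt; apply: contrapT => zv; apply: zlt.
exact: qmin.
Qed.

(** * Rays issuing from a common point *)

(** Half-lines from [o] in a Euclidean space, described by their pairwise
    cosines through the law of cosines. *)
Definition ray_star {R : realType} {M : metricType R} {I : Type} (o : M)
    (ray : I -> set M) (cosine : I -> I -> R) (kappa : R) : Prop :=
  [/\ 0 <= kappa < 1,
      forall i, ~ ray i o,
      forall i, cosine i i = 1,
      forall i j, i <> j -> cosine i j <= kappa &
      forall i j p q, ray i p -> ray j q ->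
        mdist p q ^+ 2 =
        mdist p o ^+ 2 + mdist q o ^+ 2
          - 2 * cosine i j * (mdist p o * mdist q o)].

Section star.
Context {R : realType} {M : metricType R} {I : Type} {o : M}
  {ray : I -> set M} {cosine : I -> I -> R} {kappa : R}.
Hypothesis star : ray_star o ray cosine kappa.

Lemma ray_gt0 i p : ray i p -> 0 < mdist p o.
Proof.
move: star => [_ no _ _ _] ip; rewrite mdist_gt0; apply/eqP => po.
by apply: (no i); rewrite -po.
Qed.

Lemma same_ray_mdist i p q : ray i p -> ray i q ->
  mdist p q = `|mdist p o - mdist q o|.
Proof.
move: star => [_ _ c1 _ law] ip iq; have := law i i p q ip iq; rewrite c1 => e.
apply/eqP; rewrite -(@eqrXn2 _ 2) ?mdist_ge0// e real_normK ?num_real//.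
by apply/eqP; ring.
Qed.

Lemma same_ray_inj i p q : ray i p -> ray i q ->
  mdist p o = mdist q o -> p = q.
Proof.
move=> ip iq e; apply: mdist_positivity.
by rewrite (same_ray_mdist _ _ _ ip iq) e subrr normr0.
Qed.

(** The optimal constant is [Num.sqrt (1 - kappa ^+ 2)]; the smaller [1 - kappa]
    suffices and is also the relative length of the swept part of a ray, which
    reaches from a fraction [kappa] of its end to its end. *)
Lemma other_ray_mdist i j p q : i <> j -> ray i p -> ray j q ->
  (1 - kappa) * mdist p o <= mdist p q.
Proof.
move=> ij ip jq; have p0 := ray_gt0 _ _ ip; have q0 := ray_gt0 _ _ jq.
case: star => /andP[k0 k1] _ _ ck law.
rewrite -(@ler_pXn2r _ 2) ?nnegrE ?mdist_ge0 ?mulr_ge0 ?subr_ge0 ?mdist_ge0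
  ?(ltW k1)//.
rewrite (law _ _ _ _ ip jq).
move: (mdist p o) (mdist q o) (cosine i j) (ck _ _ ij) p0 q0 => x y c cc x0 y0.
have : c * (x * y) <= kappa * (x * y) by rewrite ler_wpM2r// mulr_ge0 ?ltW.
have := sqr_ge0 (y - kappa * x).
have : 0 <= (kappa * (1 - kappa)) * x ^+ 2.
  by rewrite !mulr_ge0 ?sqr_ge0 ?subr_ge0 // ltW.
lra.
Qed.

Lemma rays_disjoint i j p : ray i p -> ray j p -> i = j.
Proof.
move=> ip jp; apply: contrapT => ij.
have := other_ray_mdist _ _ _ _ ij ip jp; rewrite mdistxx.
rewrite leNgt mulr_gt0 ?(ray_gt0 _ _ ip)//.
by case: star => /andP[_ k1] _ _ _ _; rewrite subr_gt0.
Qed.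

(** Seen from [y], distances along a ray increase beyond the foot of the
    perpendicular, which lies within [kappa * mdist y o] of [o]. *)
Lemma mdist_other_ray_incr i y p q :
  y = o \/ (exists2 j, i <> j & ray j y) -> ray i p -> ray i q ->
  kappa * mdist y o < mdist p o -> mdist p o < mdist q o ->
  mdist p y < mdist q y.
Proof.
move=> [->//|[j ij jy]] ip iq yp pq.
have y0 := ray_gt0 _ _ jy.
case: star => _ _ _ ck law.
rewrite -(@ltr_pXn2r _ 2) ?nnegrE ?mdist_ge0//.
rewrite (law _ _ _ _ ip jy) (law _ _ _ _ iq jy).
move: (mdist p o) (mdist q o) (mdist y o) (cosine i j) (ck _ _ ij) y0 yp pq.
move=> s t r c cc r0 rs st.
have : 0 < (t - s) * (s + t - 2 * kappa * r) by rewrite mulr_gt0//; lra.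
have : c * (r * (t - s)) <= kappa * (r * (t - s)).
  by rewrite ler_wpM2r// mulr_ge0 ?ltW // subr_gt0.
lra.
Qed.

(** * The greedy walk on a locally finite set of points of the rays *)

Section walk.
Context {A : set M} {L : R}.
Hypothesis L_gt0 : 0 < L.
Hypothesis A_fin : locally_finite A.
Hypothesis A_rays : forall p, A p -> p = o \/ exists i, ray i p.
Hypothesis A_dense : forall i x, L <= x ->
  exists q, [/\ A q, ray i q & x < mdist q o < x + (1 - kappa) * x].

Lemma infinite_ray_points i : infinite_set (A `&` ray i).
Proof.
move=> fin; have [q0 [Aq0 iq0 _]] := A_dense i L (lexx L).
have [|q [Aq iq] qmax] := finite_set_argmin (fun q => - mdist q o) _ _ fin.
  by exists q0.
have [|r [Ar ir]] := A_dense i (Num.max L (mdist q o)).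
  by rewrite le_max lexx.
rewrite gt_max => /andP[/andP[_ qr] _].
by have := qmax r (conj Ar ir); rewrite lerN2 leNgt qr.
Qed.

Local Notation S := (greedy_walk A o).
Local Notation V := (visited A o).

(** The threshold [kappa * L] is fixed, rather than proportional to the position
    of the walker, so that the property passes from one step to the next. *)
Definition swept n : Prop := forall i q, A q -> ray i q -> ray i (S n) ->
  kappa * L < mdist q o -> mdist q o <= mdist (S n) o -> q \in V n.

Lemma greedy_walk_on_rays n : infinite_set A ->
  S n = o \/ exists i, ray i (S n).
Proof.
case: n => [|n] Ainf; first by left.
by have [/A_rays] := greedy_stepP A o n A_fin Ainf.
Qed.

(** If the walker arrives from another ray, from within [L], then the points
    between [kappa * L] and its new position were closer to it, hence visited.
    If it moves along its ray, only the points between the two positions are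
    new, and they were closer as well. *)
Lemma sweptS n : infinite_set A -> swept n ->
  mdist (S n) o <= L \/ (forall i, ray i (S n.+1) -> ray i (S n)) ->
  swept n.+1.
Proof.
move=> Ainf sw near_or_same i q Aq iq iS Lq.
have [_ _ greedy] := greedy_stepP A o n A_fin Ainf.
rewrite le_eqVlt => /orP[/eqP e|qS].
  by rewrite (same_ray_inj _ _ _ iq iS e) greedy_walk_visited.
apply: (visited_mono A o n) => //.
have [iSn|niSn] := pselect (ray i (S n)).
  have [|Sq] := leP (mdist q o) (mdist (S n) o); first exact: (sw i).
  apply: greedy => //; rewrite !(same_ray_mdist _ _ _ _ iSn)//.
  have SS := lt_trans Sq qS.
  by rewrite !gtr0_norm ?subr_gt0// ltrBlDr subrK.
apply: greedy => //; apply: (mdist_other_ray_incr i) => //.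
- have [->|[j jS]] := greedy_walk_on_rays n Ainf; first by left.
  by right; exists j => // ij; rewrite ij in niSn.
- case: near_or_same => [SL|/(_ _ iS)//].
  by apply: le_lt_trans Lq; rewrite ler_wpM2l//; case: star => /andP[].
Qed.

(** The walk takes infinitely many values in a locally finite set. *)
Lemma greedy_walk_reaches : infinite_set A -> exists n, L <= mdist (S n) o.
Proof.
move=> Ainf; apply: contrapT => /forallNP small.
have SL n : mdist (S n) o <= L by rewrite leNgt; apply/negP => /ltW /small.
apply: infinite_nat.
have inj : injective (fun n => S n.+1).
  move=> a b; wlog ab : a b / (a < b)%N.
    by move=> w e; case: (ltngtP a b) => // ?; [apply: w|apply/esym/w].
  move=> /= e; have [_ /negP[]] := greedy_stepP A o b A_fin Ainf.
  rewrite -e; apply: (visited_mono A o a.+1) => //.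
  exact: greedy_walk_visited.
have -> : [set: nat] = (fun n => S n.+1) @^-1` (A `&` [set y | mdist y o <= L]).
  apply/seteqP; split => // n _; split; last exact: SL.
  by have [] := greedy_stepP A o n A_fin Ainf.
by apply: finite_preimage (A_fin o L) => x y _ _; exact: inj.
Qed.

(** At the first time that the walk is at distance at least [L], the end part of
    its ray is swept and everything farther is unvisited.  The gap outwards is
    shorter than the swept part and than the distance to the other rays, so
    the walker is pushed outwards and is again in this situation. *)
Lemma greedy_walk_escapes : infinite_set A ->
  exists i n, forall m, (n <= m)%N -> ray i (S m).
Proof.
move=> Ainf.
have [] := ex_minnP (greedy_walk_reaches Ainf); move=> n nL nmin.
have before j : (j < n)%N -> mdist (S j) o < L.
  by move=> jn; rewrite ltNge; apply: contraL jn => /nmin; rewrite -leqNgt.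
have So : S n <> o by move=> e; move: nL; rewrite e mdistxx leNgt L_gt0.
have [i iSn] : exists i, ray i (S n).
  by have [/So|] := greedy_walk_on_rays n Ainf.
exists i, n.
have swn : swept n.
  elim: (n) before => [|j IH] before.
    by move=> k q _ _ ko; case: star => _ /(_ k).
  apply: sweptS => //; first by apply: IH => l lj; apply: before; exact: ltnW.
  by left; apply/ltW/before.
suff inv m : (n <= m)%N -> [/\ ray i (S m), L <= mdist (S m) o, swept m &
    forall q, q \in V m -> mdist q o <= mdist (S m) o].
  by move=> m /inv[].
move=> /subnK <-; elim: (m - n)%N => [|k]; rewrite ?addSn ?add0n.
  split=> // q /visitedP[j]; rewrite leq_eqVlt.
  move=> /orP[/eqP -> -> //|/before jL ->].
  exact/ltW/(lt_le_trans jL).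
move: (k + n)%N => {}m [iSm mL sw maxm].
have [ASm Snv greedy] := greedy_stepP A o m A_fin Ainf.
have [k0 k1] : 0 <= kappa /\ kappa < 1 by case: star => /andP[].
have m0 := lt_le_trans L_gt0 mL.
have [r [Ar ir /andP[mr rm]]] := A_dense i _ mL.
have rV : r \notin V m by apply/negP => /maxm; rewrite leNgt mr.
(* [r] is unvisited, so the walker does not move farther than to [r]. *)
have step_lt : mdist (S m.+1) (S m) < (1 - kappa) * mdist (S m) o.
  apply: (@le_lt_trans _ _ (mdist r (S m))).
    by rewrite leNgt; apply/negP => /(greedy _ Ar); exact/negP.
  by rewrite (same_ray_mdist i)// gtr0_norm ?subr_gt0// ltrBlDl.
have iSm1 : ray i (S m.+1).
  have [e|[j jS]] := A_rays _ ASm.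
    move: Snv; rewrite e; suff -> : o \in V m by [].
    exact: (visited_mono A o 0 m o (leq0n m) (greedy_walk_visited A o 0)).
  have [->//|ij] := pselect (i = j).
  have := other_ray_mdist i j (S m) (S m.+1) ij iSm jS.
  by rewrite [mdist (S m) (S _)]metric_sym leNgt step_lt.
(* Moving inwards within [step_lt] would end in the swept part. *)
have out : mdist (S m) o < mdist (S m.+1) o.
  rewrite ltNge; apply/negP => inn; move/negP: Snv; apply.
  apply: (sw i) => //.
  move: step_lt; rewrite (same_ray_mdist i)// ler0_norm ?subr_le0// => h.
  have : kappa * L <= kappa * mdist (S m) o by rewrite ler_wpM2l.
  lra.
split=> //.
- exact/ltW/(le_lt_trans mL).
- by apply: sweptS => //; right => j jS; rewrite (rays_disjoint j i (S m.+1)).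
- move=> q; rewrite visitedS inE => /orP[/eqP ->//|/maxm qm].
  exact: le_trans qm (ltW out).
Qed.

Lemma greedy_walk_finite_on_other_rays : infinite_set A ->
  exists i, forall j, j <> i -> finite_set (range S `&` ray j).
Proof.
move=> /greedy_walk_escapes[i [n esc]]; exists i => j ji.
apply: sub_finite_set (finite_image S (finite_II n)) => p [[m _ <-] jS].
exists m => //=; rewrite ltnNge; apply/negP => /esc iS; apply: ji.
exact: rays_disjoint jS iS.
Qed.
End walk.
End star.

(** * The four half-lines of the plane *)

(** The cosine of two half-lines is that of the lines, [rho], up to the signs of
    the sides.  On the same line [rho] is 1, so opposite sides have cosine -1;
    on different lines [rho] is less than 1 in absolute value because
    [(1 + m1^2) (1 + m2^2) - (1 + m1 m2)^2 = (m1 - m2)^2]. *)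
Lemma half_lines_cosine_law {R : realType} (m1 m2 : R) : m1 <> m2 ->
  exists (kappa : R) (cosine : bool * bool -> bool * bool -> R),
    ray_star (origin R) (half_line m1 m2) cosine kappa.
Proof.
move=> m12.
pose m (h : bool * bool) := if h.1 then m1 else m2.
pose sg (h : bool * bool) : R := if h.2 then 1 else -1.
pose L h := Num.sqrt (1 + m h ^+ 2).
have L0 h : 0 < L h by rewrite sqrtr_gt0 ltr_pwDl ?sqr_ge0.
have L2 h : L h ^+ 2 = 1 + m h ^+ 2.
  by rewrite sqr_sqrtr// ltW// ltr_pwDl ?sqr_ge0.
pose rho h k := (1 + m h * m k) / (L h * L k).
pose kappa := `|(1 + m1 * m2) / (L (true, true) * L (false, true))|.
exists kappa, (fun h k => sg h * sg k * rho h k).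
have dist_origin h p : half_line m1 m2 h p ->
    p.1 = sg h * (mdist p (origin R) / L h) /\ p.2 = m h * p.1.
  move=> [e s]; split => //.
  have -> : mdist p (origin R) = L h * `|p.1|.
    rewrite -[LHS]/(Defs.edist _ _) /Defs.edist /= !subr0 e -/(m h).
    rewrite -sqrtr_sqr -sqrtrM ?addr_ge0 ?sqr_ge0//; congr Num.sqrt; ring.
  rewrite [L h * _]mulrC mulfK ?gt_eqF// /sg.
  case: h.2 s => s; first by rewrite gtr0_norm ?mul1r.
  by rewrite ltr0_norm ?mulN1r ?opprK.
have sg2 h : sg h * sg h = 1 by rewrite /sg; case: h.2; rewrite ?mulrNN mulr1.
split.
- rewrite normr_ge0/= -(@expr_lt1 _ 2) ?normr_ge0// /kappa.
  rewrite real_normK ?num_real// expr_div_n exprMn !L2 /m /=.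
  rewrite ltr_pdivrMr ?mulr_gt0 ?ltr_pwDl ?sqr_ge0// mul1r -subr_gt0.
  have -> : (1 + m1 ^+ 2) * (1 + m2 ^+ 2) - (1 + m1 * m2) ^+ 2 =
    (m1 - m2) ^+ 2 by ring.
  by rewrite lt0r sqr_ge0 sqrf_eq0 subr_eq0 andbT; apply/eqP.
- by move=> h [_]; rewrite /origin/=; case: h.2; rewrite ltxx.
- move=> h; rewrite sg2 mul1r /rho -!expr2 L2 divff// gt_eqF//.
  by rewrite ltr_pwDl ?sqr_ge0.
- have rhoC h k : rho h k = rho k h.
    by rewrite /rho [L h * _]mulrC [m h * _]mulrC.
  have rho1 h k : h.1 = k.1 -> rho h k = 1.
    rewrite /rho /L /m => ->.
    by rewrite -!expr2 sqr_sqrtr ?divff ?gt_eqF ?ltW// ltr_pwDl ?sqr_ge0.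
  have sgN h k : sg h * sg k = 1 \/ sg h * sg k = -1.
    by rewrite /sg; case: h.2; case: k.2; rewrite ?mulrNN ?mulr1 ?mul1r; auto.
  move=> h k hk; have [e|ne] := eqVneq h.1 k.1.
    rewrite rho1// mulr1; suff -> : sg h * sg k = -1.
      by rewrite (le_trans _ (normr_ge0 _))// oppr_le0.
    case: h k e hk => [? a] [? b] /= -> ab; rewrite /sg/=.
    by case: a b ab => [] [] // _; rewrite ?mulr1 ?mul1r.
  have -> : kappa = `|rho h k|.
    case: h k ne {hk} => [[] a] [[] b]// _.
    by rewrite rhoC.
  apply: le_trans (ler_norm _) _.
  by rewrite normrM; case: (sgN h k) => ->; rewrite ?normrN normr1 mul1r.
- move=> h k p q /dist_origin + /dist_origin.
  move: (mdist p (origin R)) (mdist q (origin R)) => x y [ep1 ep2] [eq1 eq2].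
  rewrite -[mdist p q]/(Defs.edist _ _) /Defs.edist.
  rewrite sqr_sqrtr ?addr_ge0 ?sqr_ge0//.
  rewrite ep2 eq2 ep1 eq1.
  have -> : (sg h * (x / L h) - sg k * (y / L k)) ^+ 2 +
    (m h * (sg h * (x / L h)) - m k * (sg k * (y / L k))) ^+ 2
    = (sg h * sg h) * (1 + m h ^+ 2) * (x / L h) ^+ 2
      + (sg k * sg k) * (1 + m k ^+ 2) * (y / L k) ^+ 2
      - 2 * (sg h * sg k * ((1 + m h * m k) * (x / L h * (y / L k)))) by ring.
  rewrite !sg2 -!L2 /rho; field.
  by rewrite !gt_eqF.
Qed.

Lemma line_point0 {R : realType} (m : R) : line_point m 0 = origin R.
Proof. by rewrite /line_point mul0r mulr0. Qed.

Lemma mdist_line_point_origin {R : realType} (m t : R) :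
  mdist (line_point m t) (origin R) = `|t|.
Proof. by rewrite -(line_point0 m) mdist_line_point subr0. Qed.

Lemma half_line_line_point {R : realType} (m1 m2 : R) (b : bool) (t : R) :
  (0 < t -> half_line m1 m2 (b, true) (line_point (if b then m1 else m2) t)) /\
  (t < 0 -> half_line m1 m2 (b, false) (line_point (if b then m1 else m2) t)).
Proof.
have q0 m : 0 < Num.sqrt (1 + m ^+ 2) :> R.
  by rewrite sqrtr_gt0 ltr_pwDl ?sqr_ge0.
by split=> t0; split=> //=; rewrite ?divr_gt0// pmulr_llt0// invr_gt0.
Qed.

Lemma locally_finite_line_points {R : realType} (m : R) (B : set R) :
  (forall a b, finite_set (B `&` `[a, b])) ->
  locally_finite (line_point m @` B : set (plane R)).
Proof.
move=> Bfin x r; pose s := r + mdist x (origin R).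
apply: sub_finite_set (finite_image (line_point m) (Bfin (- s) s)).
move=> _ [[t Bt <-] tx]; exists t => //; split => //=.
rewrite in_itv /= -ler_norml -(mdist_line_point_origin m).
by apply: le_trans (metric_triangle _ x _) _; rewrite lerD2r.
Qed.

Lemma locally_finiteU {R : realType} {M : metricType R} (A B : set M) :
  locally_finite A -> locally_finite B -> locally_finite (A `|` B).
Proof. by move=> Af Bf x r; rewrite setIUl finite_setU. Qed.

(** * Gaps of a Poisson process *)

Lemma count_set0 {R : realType} {T : Type} (Pi : T -> set R) (B : set R)
    (w : T) : Pi w `&` B = set0 -> Defs.count Pi B w = 0%E.
Proof.
move=> e; rewrite /Defs.count /counting e asboolT; last exact: finite_set0.
by rewrite fset_set0 cardfs0.
Qed.

(** [B k] is missed with probability [expR (- a) ^+ k], which is summable. *)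
Lemma poisson_eventually_hits {R : realType} {d : measure_display}
    {T : measurableType d} (P : probability T R) (Pi : T -> set R)
    (B : nat -> set R) (a : R) :
  homogeneous_poisson P 1 Pi -> 0 < a ->
  (forall k, measurable (B k)) ->
  (forall k, lebesgue_measure (B k) = (a * k%:R)%:E) ->
  {ae P, forall w, exists n, forall k, (n <= k)%N -> Pi w `&` B k !=set0}.
Proof.
move=> [[_ mcount] void _] a0 mB lB.
pose F k := [set w | Defs.count Pi (B k) w = 0%E].
have mF k : measurable (F k).
  have -> : F k = setT `&` Defs.count Pi (B k) @^-1` [set 0%E] by rewrite setTI.
  exact: mcount.
have PF k : P (F k) = (expR (- a) ^+ k)%:E.
  have -> : F k = [set w | Defs.count Pi (B k) w = 0%:R%:E] by [].
  rewrite void ?lB ?ltry//= expr0 fact0 divr1 !mul1r.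
  by rewrite -expRM_natr mulNr.
have z1 : `|expR (- a)| < 1 by rewrite gtr0_norm ?expR_gt0// expR_lt1 oppr_lt0.
have limsup0 : P (lim_sup_set F) = 0%E.
  apply: lim_sup_set_cvg0 => //.
  have h : cvgn (series (geometric 1 (expR (- a)))).
    exact: is_cvg_geometric_series z1.
  rewrite (_ : (fun n => _) = EFin \o series (geometric 1 (expR (- a)))).
    by rewrite EFin_lim// ltry.
  apply/funext => n /=; rewrite /series/= -sumEFin.
  by apply: eq_bigr => i _; rewrite PF mul1r.
exists (lim_sup_set F); split=> //.
  by apply: bigcap_measurable => // n _; exact: bigcup_measurable.
move=> w /= /forallNP miss n _.
have /existsNP[k /not_implyP[nk Bk]] := miss n.
by exists k => //; apply: count_set0; apply: contrapT => /eqP/set0P.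
Qed.

Lemma lebesgue_measure_oo {R : realType} (a b : R) : a <= b ->
  lebesgue_measure (`]a, b[%classic : set R) = (b - a)%:E.
Proof.
move=> ab; rewrite lebesgue_measure_itv /= lte_fin; case: ltP => // ba.
by rewrite (@le_anti _ _ a b) ?ab// subrr.
Qed.

(** With [k] the integer following [x] and [x] large, the interval from [k] to
    [k + (e / 2) k] lies within [x] and [x + e x], so that countably many
    intervals suffice. *)
Lemma poisson_dense {R : realType} {d : measure_display}
    {T : measurableType d} (P : probability T R) (Pi : T -> set R) (e : R) :
  homogeneous_poisson P 1 Pi -> 0 < e ->
  {ae P, forall w, exists L, forall x, L <= x ->
    (exists2 t, Pi w t & x < t < x + e * x) /\
    (exists2 t, Pi w t & x < - t < x + e * x)}.
Proof.
move=> hPi e0; pose a := e / 2; have a0 : 0 < a by rewrite divr_gt0.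
pose B k : set R := `]k%:R, k%:R + a * k%:R[%classic.
pose B' k : set R := `](- (k%:R + a * k%:R)), (- k%:R)[%classic.
have ak k : 0 <= a * k%:R by rewrite mulr_ge0 ?ler0n ?ltW.
have right_side : {ae P, forall w, exists n, forall k, (n <= k)%N ->
    Pi w `&` B k !=set0}.
  apply: poisson_eventually_hits hPi a0 _ _ => k; first exact: measurable_itv.
  by rewrite lebesgue_measure_oo ?lerDl// addrC addKr.
have left_side : {ae P, forall w, exists n, forall k, (n <= k)%N ->
    Pi w `&` B' k !=set0}.
  apply: poisson_eventually_hits hPi a0 _ _ => k; first exact: measurable_itv.
  by rewrite lebesgue_measure_oo ?lerN2 ?lerDl// opprK addKr.
apply: filterS2 right_side left_side => w [n hn] [n' hn'].
exists (n%:R + n'%:R + (1 + a^-1)) => x Lx.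
pose k := (Num.truncn x).+1.
have n0 : 0 <= n%:R :> R by [].
have n'0 : 0 <= n'%:R :> R by [].
have ia : 0 < a^-1 by rewrite invr_gt0.
have x0 : 0 <= x by lra.
have /andP[kx xk] := Num.Theory.truncn_itv x0.
have le_k j : j%:R <= x -> (j <= k)%N.
  by move=> jx; rewrite -(ler_nat R); apply: le_trans jx (ltW xk).
have kxe : k%:R + a * k%:R <= x + e * x.
  have kx1 : k%:R <= x + 1 by rewrite /k -natr1 lerD2r.
  have : (1 + a) * k%:R <= (1 + a) * (x + 1).
    by rewrite ler_wpM2l// ltW// addr_gt0.
  have : a * (1 + a^-1) <= a * x by rewrite ler_pM2l//; lra.
  rewrite mulrDr mulr1 divff ?gt_eqF//.
  have -> : e = 2 * a by rewrite /a; field.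
  lra.
have [t [Pt]] : Pi w `&` B k !=set0 by apply/hn/le_k; lra.
rewrite /B /= in_itv /= => /andP[kt tk].
have [s [Ps]] : Pi w `&` B' k !=set0 by apply/hn'/le_k; lra.
rewrite /B' /= in_itv /= => /andP[ks sk].
split; [exists t|exists s] => //; apply/andP; split.
- exact: lt_trans xk kt.
- exact: lt_le_trans tk kxe.
- by apply: lt_trans xk _; rewrite ltrNr.
- by apply: lt_le_trans kxe; rewrite ltrNl.
Qed.

(** * The walk on two lines *)

Lemma two_line_greedy_walk {R : realType} (m1 m2 kappa L : R)
    (cosine : bool * bool -> bool * bool -> R) (A1 A2 : set R) :
  ray_star (origin R) (half_line m1 m2) cosine kappa ->
  (forall a b, finite_set (A1 `&` `[a, b])) ->
  (forall a b, finite_set (A2 `&` `[a, b])) ->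
  (forall b x, L <= x ->
    (exists2 t, (if b then A1 else A2) t & x < t < x + (1 - kappa) * x) /\
    (exists2 t, (if b then A1 else A2) t & x < - t < x + (1 - kappa) * x)) ->
  let A := (line_point m1 @` A1) `|` (line_point m2 @` A2) in
  ~ A `<=` range (greedy_walk A (origin R)) /\
  exists h, forall h', h' <> h ->
    finite_set (range (greedy_walk A (origin R)) `&` half_line m1 m2 h').
Proof.
move=> star fin1 fin2 dense A.
have A_line b t : (if b then A1 else A2) t ->
    A (line_point (if b then m1 else m2) t).
  by case: b => At; [left|right]; exists t.
have A_fin : locally_finite A.
  by apply: locally_finiteU; exact: locally_finite_line_points.
have A_rays p : A p -> p = origin R \/ exists h, half_line m1 m2 h p.
  have on b t : line_point (if b then m1 else m2) t = origin R \/
      exists h, half_line m1 m2 h (line_point (if b then m1 else m2) t).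
    have [pos neg] := half_line_line_point m1 m2 b t.
    case: (ltgtP t 0) => [/neg on|/pos on|->].
    + by right; exists (b, false).
    + by right; exists (b, true).
    + by left; exact: line_point0.
  by move=> [[t _ <-]|[t _ <-]]; [exact: (on true)|exact: (on false)].
pose L' := Num.max 1 L.
have L'0 : 0 < L' by rewrite lt_max ltr01.
have A_dense h x : L' <= x -> exists q, [/\ A q, half_line m1 m2 h q &
    x < mdist q (origin R) < x + (1 - kappa) * x].
  rewrite ge_max => /andP[x1 Lx]; have x0 := lt_le_trans ltr01 x1.
  case: h => b s; have [[t At xt] [u Au xu]] := dense b x Lx.
  have [t0 u0] : 0 < t /\ u < 0.
    rewrite -[u < 0]oppr_gt0.
    by split; apply: lt_trans x0 _; [case/andP: xt|case/andP: xu].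
  have [post _] := half_line_line_point m1 m2 b t.
  have [_ negu] := half_line_line_point m1 m2 b u.
  case: s.
    exists (line_point (if b then m1 else m2) t).
    split; [exact: A_line|exact: post|].
    by rewrite mdist_line_point_origin gtr0_norm.
  exists (line_point (if b then m1 else m2) u).
  split; [exact: A_line|exact: negu|].
  by rewrite mdist_line_point_origin ltr0_norm.
have ray_inf h : infinite_set (A `&` half_line m1 m2 h).
  exact: infinite_ray_points A_dense h.
have A_inf : infinite_set A.
  by move=> Af; apply: (ray_inf (true, true)); exact: finite_setIl.
have [h hfin] :=
  greedy_walk_finite_on_other_rays star L'0 A_fin A_rays A_dense A_inf.
split; last by exists h.
move=> AS; pose h' := (~~ h.1, h.2).
have hh' : h' <> h by rewrite /h'; case: (h) => [[] ?].
by apply: (ray_inf h'); apply: sub_finite_set (hfin h' hh') => p [/AS].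
Qed.

Theorem theorem1 (R : realType) (d : measure_display) (T : measurableType d)
    (P : probability T R) (m1 m2 : R) (Pi1 Pi2 : T -> set R)
    (hm : m1 <> m2)
    (hPi1 : homogeneous_poisson P 1 Pi1)
    (hPi2 : homogeneous_poisson P 1 Pi2)
    (hind : independent_processes P Pi1 Pi2) :
  let Pi := two_line_process m1 m2 Pi1 Pi2 in
  let S := fun w : T => greedy_walk (Pi w) (origin R) in
  {ae P, forall w, ~ (Pi w `<=` range (S w))} /\
  {ae P, forall w, exists h : bool * bool,
    forall h' : bool * bool, h' <> h ->
      finite_set (range (S w) `&` half_line m1 m2 h')}.
Proof.
move=> Pi S.
have [kappa [cosine star]] := half_lines_cosine_law m1 m2 hm.
have kappa1 : 0 < 1 - kappa by case: star => /andP[_]; rewrite subr_gt0.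
have [[fin1 _] _ _] := hPi1; have [[fin2 _] _ _] := hPi2.
suff both : {ae P, forall w, ~ (Pi w `<=` range (S w)) /\
    exists h, forall h', h' <> h ->
      finite_set (range (S w) `&` half_line m1 m2 h')}.
  by split; apply: filterS both => w [].
apply: filterS2 (poisson_dense P Pi1 _ hPi1 kappa1)
  (poisson_dense P Pi2 _ hPi2 kappa1) => w [L1 dense1] [L2 dense2].
apply: (two_line_greedy_walk _ _ _ (Num.max L1 L2) _ _ _ star) => // b x.
by rewrite ge_max => /andP[L1x L2x]; case: b; [exact: dense1|exact: dense2].
Qed.
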